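(* Consider the one-way normal-inverse-Gamma Markov grove (NIG-MG) model on the tree $\mathcal{T}$ with data $\mathcal{D}$, as described in the context. For $(j,k)\in\mathcal{T}$ and $s\in\{0,1\}$ let $$\varphi_{j,k}(s)=\Pr\left(R_{j',k'}=0\text{ for all }(j',k')\in\mathcal{T}(j,k)\ \middle|\ S_{j-1,\lfloor k/2\rfloor}=s,\ R_{j-1,\lfloor k/2\rfloor}=0,\ \mathcal{D}\right),$$ where $\mathcal{T}(j,k)$ denotes the subtree of $\mathcal{T}$ consisting of $(j,k)$ and all of its descendants; for the root $(j,k)=(0,0)$, which has no parent, the conditioning is on $\mathcal{D}$ only. Then $\varphi_{j,k}(s)$ can be computed by the bottom-up recursion $$\varphi_{j,k}(s)=\begin{cases}\sum_{s'\in\{0,1\}}P_{j,k}(s',0\mid s,0)\,\varphi_{j+1,2k}(s')\,\varphi_{j+1,2k+1}(s') & j<J,\\[2pt] \sum_{s'\in\{0,1\}}P_{j,k}(s',0\mid s,0) & j=J,\end{cases}$$ where $P_{j,k}(s',r'\mid s,r)=\Pr(S_{j,k}=s',R_{j,k}=r'\mid S_{j-1,\lfloor k/2\rfloor}=s,R_{j-1,\lfloor k/2\rfloor}=r,\mathcal{D})$ are the posterior transition probabilities (for $j=0$: the posterior initial probabilities $P_{0,0}(s',r'\mid s,r)=\Pr(S_{0,0}=s',R_{0,0}=r'\mid\mathcal{D})$). Moreover, the posterior joint null probability is $$\Pr(R_{j,k}=0\text{ for all }(j,k)\in\mathcal{T}\mid\mathcal{D})=\varphi_{0,0}(0),$$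 and accordingly the posterior joint alternative probability $\Pr(R_{j,k}=1\text{ for some }(j,k)\in\mathcal{T}\mid\mathcal{D})$ equals $1-\varphi_{0,0}(0)$.
   Context: Tree. Fix an integer $J\ge 0$ and let $\mathcal{T}=\{(j,k): 0\le j\le J,\ 0\le k\le 2^j-1\}$ be the bifurcating tree with root $(0,0)$; the children of $(j,k)$ (for $j<J$) are $(j+1,2k)$ and $(j+1,2k+1)$, and the parent of $(j,k)$ (for $j\ge1$) is $(j-1,\lfloor k/2\rfloor)$. Markov tree (MT). For a finite state space $E$, an initial probability vector $q_{0,0}$ on $E$ and, for each $(j,k)$ with $j\ge1$, a stochastic matrix $q_{j,k}(\cdot,\cdot)$ on $E$, a collection $\{X_{j,k}:(j,k)\in\mathcal{T}\}$ of $E$-valued random variables is an MT with these initial and transition probabilities if for all $(x_{j,k})\in E^{\mathcal{T}}$, $\Pr(X_{j,k}=x_{j,k}\ \forall (j,k)\in\mathcal{T})=q_{0,0}(x_{0,0})\prod_{(j,k):\,j\ge1}q_{j,k}(x_{j-1,\lfloor k/2\rfloor},x_{j,k})$. Conventions. $\mathrm{N}(\mu,0)$ is the point mass at $\mu$. $\text{Inv-Gamma}(a,b)$ has density $\frac{b^a}{\Gamma(a)}x^{-a-1}e^{-b/x}$ on $(0,\infty)$. A prime on a vector or matrix denotes transpose; $\mathbf 1_m$ is the vector of $m$ ones. NIG-MG prior (one factor with $G\ge 2$ levels). Hyperparameters: $\nu>0$, $\sigma_0^2>0$, $\tau_j=2^{-\alpha j}\tau$, $\upsilon_j=2^{-\alpha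 j}\upsilon$ with $\alpha,\tau,\upsilon>0$; probability vectors $\rho_{0,0},\kappa_{0,0}$ on $\{0,1\}$; and $2\times2$ stochastic matrices $\rho_{j,k},\kappa_{j,k}$ (indexed by $\{0,1\}$) for $j\ge1$. The families $\{S_{j,k}\}$ and $\{R_{j,k}\}$ are independent $\{0,1\}$-valued MTs with initial/transition probabilities $\rho$ and $\kappa$ respectively. The $\sigma_{j,k}^2$ are independent $\text{Inv-Gamma}(\nu+1,\nu\sigma_0^2)$, independent of the hidden states. Given all hidden states and variances, all the $z_{j,k}$ and $\beta_{j,k}^{(g)}$ ($g=2,\dots,G$) are independent with $z_{j,k}\sim\mathrm{N}(0,S_{j,k}\tau_j\sigma_{j,k}^2)$ and $\beta_{j,k}^{(g)}\sim\mathrm{N}(0,R_{j,k}\upsilon_j\sigma_{j,k}^2)$. Set $\beta_{j,k}^{(1)}=0$. Data model. There are $n_g\ge1$ replicates in group $g$, $n=\sum_{g=1}^G n_g$. Given all parameters and hidden states, $d_{j,k}^{(g,i)}=z_{j,k}+\beta_{j,k}^{(g)}+u_{j,k}^{(g,i)}$ for $g=1,\dots,G$, $i=1,\dots,n_g$, with $u_{j,k}^{(g,i)}\sim\mathrm{N}(0,\sigma_{j,k}^2)$ independent over $g,i,j,k$. Let $\boldsymbol d_{j,k}=(d_{j,k}^{(1,1)},\dots,d_{j,k}^{(G,n_G)})'\in\mathbb{R}^n$ and $\mathcal{D}=\{\boldsymbol d_{j,k}:(j,k)\in\mathcal{T}\}$. Node-specific marginal likelihood. $\boldsymbol e_g\in\{0,1\}^n$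 has $h$th entry $1$ iff the $h$th observation belongs to group $g$. For $s,r\in\{0,1\}$: $X(s,r)=(s\mathbf 1_n,r\boldsymbol e_2,\dots,r\boldsymbol e_G)$, $\Lambda_j=\mathrm{diag}(1/\tau_j,1/\upsilon_j,\dots,1/\upsilon_j)$ ($G-1$ copies of $1/\upsilon_j$), $\Lambda_j^*(s,r)=X(s,r)'X(s,r)+\Lambda_j$, $\boldsymbol\mu_{j,k}^*(s,r)=[\Lambda_j^*(s,r)]^{-1}X(s,r)'\boldsymbol d_{j,k}$, $\Upsilon_{j,k}(s,r)=\frac12\{\boldsymbol d_{j,k}'\boldsymbol d_{j,k}-[\boldsymbol\mu_{j,k}^*(s,r)]'\Lambda_j^*(s,r)\boldsymbol\mu_{j,k}^*(s,r)\}$. The marginal density $m_{j,k}(s,r)$ of $\boldsymbol d_{j,k}$ given $S_{j,k}=s,R_{j,k}=r$ is $$m_{j,k}(s,r)=\frac{(\nu\sigma_0^2)^{\nu+1}\Gamma(\nu+n/2+1)}{(2\pi)^{n/2}\Gamma(\nu+1)}\cdot\frac{|\Lambda_j|^{1/2}}{|\Lambda_j^*(s,r)|^{1/2}}\cdot[\nu\sigma_0^2+\Upsilon_{j,k}(s,r)]^{-\nu-n/2-1}.$$ Posterior law of the hidden states. For $s,r\in\{0,1\}$ let $\phi_{j,k}(s,r)=m_{j,k}(s,r)$ for $j=J$ and $\phi_{j,k}(s,r)=m_{j,k}(s,r)\,\xi_{j+1,2k}(s,r)\,\xi_{j+1,2k+1}(s,r)$ for $j<J$; $\xi_{j,k}(s,r)=\sum_{s',r'}\rho_{j,k}(s,s')\kappa_{j,k}(r,r')\phi_{j,k}(s',r')$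 for $j\ge1$ and $\xi_{0,0}(s,r)=\sum_{s',r'}\rho_{0,0}(s')\kappa_{0,0}(r')\phi_{0,0}(s',r')$. Given $\mathcal{D}$, $\{(S_{j,k},R_{j,k})\}$ is an MT on $\{0,1\}^2$ with transition probabilities $P_{j,k}(s',r'\mid s,r)=\rho_{j,k}(s,s')\kappa_{j,k}(r,r')\phi_{j,k}(s',r')/\xi_{j,k}(s,r)$ for $j\ge1$ and initial probabilities $\rho_{0,0}(s)\kappa_{0,0}(r)\phi_{0,0}(s,r)/\xi_{0,0}(0,0)$. Conditional probabilities given the state of a parent node and $\mathcal{D}$ are understood through these transition kernels (this matters only when the conditioning event has probability zero). *)

(* Defs.v *)
From mathcomp Require Import all_boot all_order all_algebra.
From mathcomp Require Import all_classical all_reals all_analysis.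

Set Implicit Arguments.
Unset Strict Implicit.
Unset Printing Implicit Defensive.

Import Order.TTheory GRing.Theory Num.Theory.
Import numFieldNormedType.Exports.

Local Open Scope classical_set_scope.
Local Open Scope ring_scope.

(* The slack in the bound on the second component only serves to make [mknode]
   definable with [inord]. *)
Definition node (J : nat) : Type :=
  {p : 'I_J.+1 * 'I_(2 ^ J).+1 | (p.2 < 2 ^ p.1)%N}.

Definition lev J (p : node J) : nat := (val p).1.
Definition idx J (p : node J) : nat := (val p).2.

Definition root_node J : node J := Sub (ord0, ord0) isT.

(* The node (j, k); meaningful only when j <= J and k < 2 ^ j. *)
Definition mknode J (j k : nat) : node J := insubd (root_node J) (inord j, inord k).

(* With truncated predecessor, the root is its own parent. *)
Definition parent J (p : node J) : node J := mknode J (lev p).-1 (idx p)./2.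

(* [child p false] is (j+1, 2k) and [child p true] is (j+1, 2k+1);
   meaningful only when lev p < J. *)
Definition child J (p : node J) (b : bool) : node J :=
  mknode J (lev p).+1 ((idx p).*2 + b).

Definition subtree J (p : node J) : {set node J} :=
  [set q | fconnect (@parent J) q p]%SET.

Definition prob_vector (R : realType) (E : finType) (q : E -> R) : Prop :=
  (forall e, 0 <= q e) /\ \sum_e q e = 1.

(* The value of [q] at the root is never used. *)
Definition is_MT d (T : measurableType d) (R : realType) (Pr : probability T R)
    (J : nat) (E : finType) (q0 : E -> R) (q : node J -> E -> E -> R)
    (X : node J -> T -> E) : Prop :=
  forall x : {ffun node J -> E},
    Pr [set w | forall p, X p w = x p] =
    (q0 (x (root_node J)) *
     \prod_(p | p != root_node J) q p (x (parent p)) (x p))%:E.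

(* Independence of two families of random variables with values in a finite
   set. *)
Definition indep_families d (T : measurableType d) (R : realType)
    (Pr : probability T R) (J : nat) (E : finType)
    (X Y : node J -> T -> E) : Prop :=
  forall x y : {ffun node J -> E},
    Pr [set w | (forall p, X p w = x p) /\ (forall p, Y p w = y p)] =
    (Pr [set w | forall p, X p w = x p] *
     Pr [set w | forall p, Y p w = y p])%E.

(* [tau] and [upsilon] are the constants that do not depend on the level;
   see [tau_ j] and [upsilon_ j].  States 0 and 1 are [false] and [true]. *)
Record hyperparameters (R : realType) (J : nat) := Hyperparameters {
  nu : R;
  sigma02 : R;
  alpha : R;
  tau : R;
  upsilon : R;
  rho0 : bool -> R;
  kappa0 : bool -> R;
  rho : node J -> bool -> bool -> R;
  kappa : node J -> bool -> bool -> R;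
  nu_gt0 : 0 < nu;
  sigma02_gt0 : 0 < sigma02;
  alpha_gt0 : 0 < alpha;
  tau_gt0 : 0 < tau;
  upsilon_gt0 : 0 < upsilon;
  rho0_prob : prob_vector rho0;
  kappa0_prob : prob_vector kappa0;
  rho_prob : forall p s, p != root_node J -> prob_vector (rho p s);
  kappa_prob : forall p r, p != root_node J -> prob_vector (kappa p r)
}.

Definition tau_ (R : realType) J (H : hyperparameters R J) (j : nat) : R :=
  2 `^ (- alpha H * j%:R) * tau H.

Definition upsilon_ (R : realType) J (H : hyperparameters R J) (j : nat) : R :=
  2 `^ (- alpha H * j%:R) * upsilon H.

Definition Gamma (R : realType) (a : R) : R :=
  \int[@lebesgue_measure R]_(t in `]0, +oo[) (t `^ (a - 1) * expR (- t)).

(* The observation [d p g i]; group g of the G groups is the ordinal g - 1, so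
   that the baseline group is the one with value 0. *)
Definition dataset (R : realType) (J G : nat) (n : 'I_G -> nat) : Type :=
  node J -> forall g : 'I_G, 'I_(n g) -> R.

Definition dvec (R : realType) J G (n : 'I_G -> nat) (d : dataset R J n)
    (p : node J) : 'cV[R]_(\sum_g n g) :=
  \mxcol_g \col_i d p g i.

(* Column 0 is s 1_n, column g > 0 is r e_g; [tagnat.sig1 h] is the group of
   the h-th observation. *)
Definition design (R : realType) G (n : 'I_G -> nat) (s r : bool) :
    'M[R]_(\sum_g n g, G) :=
  \matrix_(h, g) (if g == 0%N :> nat then s%:R
                  else (r && (tagnat.sig1 h == g))%:R).

Definition Lambda (R : realType) J (H : hyperparameters R J) (G j : nat) :
    'M[R]_G :=
  diag_mx (\row_g (if g == 0%N :> nat then (tau_ H j)^-1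
                   else (upsilon_ H j)^-1)).

Definition Lambda_star (R : realType) J (H : hyperparameters R J) G
    (n : 'I_G -> nat) (j : nat) (s r : bool) : 'M[R]_G :=
  (design R n s r)^T *m design R n s r + Lambda H G j.

Definition mu_star (R : realType) J (H : hyperparameters R J) G
    (n : 'I_G -> nat) (d : dataset R J n) (p : node J) (s r : bool) :
    'cV[R]_G :=
  invmx (Lambda_star H n (lev p) s r) *m (design R n s r)^T *m dvec d p.

Definition Upsilon (R : realType) J (H : hyperparameters R J) G
    (n : 'I_G -> nat) (d : dataset R J n) (p : node J) (s r : bool) : R :=
  2^-1 * ((dvec d p)^T *m dvec d p -
          (mu_star H d p s r)^T *m Lambda_star H n (lev p) s r
            *m mu_star H d p s r) 0 0.

(* The density of the data at node p given S p = s and R p = r, all the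
   z, beta and sigma^2 being integrated out. *)
Definition marglik (R : realType) J (H : hyperparameters R J) G
    (n : 'I_G -> nat) (d : dataset R J n) (p : node J) (s r : bool) : R :=
  let n2 := (\sum_g n g)%:R / 2 in
  let b := nu H * sigma02 H in
  (b `^ (nu H + 1) * Gamma (nu H + n2 + 1)) /
    ((2 * pi) `^ n2 * Gamma (nu H + 1)) *
  (Num.sqrt (\det (Lambda H G (lev p))) /
   Num.sqrt (\det (Lambda_star H n (lev p) s r))) *
  (b + Upsilon H d p s r) `^ (- nu H - n2 - 1).

(* Prior probability of moving from (s, r) at the parent of p to (s', r') at
   p; the prior initial probability, whatever (s, r), when p is the root. *)
Definition prior_trans (R : realType) J (H : hyperparameters R J)
    (p : node J) (e e' : bool * bool) : R :=
  if p == root_node J then rho0 H e'.1 * kappa0 H e'.2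
  else rho H p e.1 e'.1 * kappa H p e.2 e'.2.

(* [phi_rec h p] is phi at a node p of height h, i.e. of level J - h. *)
Fixpoint phi_rec (R : realType) J (H : hyperparameters R J) G
    (n : 'I_G -> nat) (d : dataset R J n) (h : nat) (p : node J)
    (e : bool * bool) : R :=
  if h is h'.+1 then
    let xi c := \sum_e' prior_trans H c e e' * phi_rec H d h' c e' in
    marglik H d p e.1 e.2 * xi (child p false) * xi (child p true)
  else marglik H d p e.1 e.2.

Definition phi (R : realType) J (H : hyperparameters R J) G
    (n : 'I_G -> nat) (d : dataset R J n) (p : node J) (e : bool * bool) : R :=
  phi_rec H d (J - lev p) p e.

Definition xi (R : realType) J (H : hyperparameters R J) G
    (n : 'I_G -> nat) (d : dataset R J n) (p : node J) (e : bool * bool) : R :=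
  \sum_e' prior_trans H p e e' * phi H d p e'.

(* P_{j,k}(s', r' | s, r), with e = (s, r) and e' = (s', r'); at the root it
   does not depend on e. *)
Definition post_trans (R : realType) J (H : hyperparameters R J) G
    (n : 'I_G -> nat) (d : dataset R J n) (p : node J)
    (e e' : bool * bool) : R :=
  prior_trans H p e e' * phi H d p e' / xi H d p e.

Definition config (J : nat) : Type := {ffun node J -> bool * bool}.

Definition hidden J T (S Rh : node J -> T -> bool) (w : T) : config J :=
  [ffun p => (S p w, Rh p w)].

(* Likelihood of the hidden states: given them, the data at distinct nodes are
   independent. *)
Definition likelihood (R : realType) J (H : hyperparameters R J) G
    (n : 'I_G -> nat) (d : dataset R J n) (x : config J) : R :=
  \prod_p marglik H d p (x p).1 (x p).2.

(* Pr(hidden states in A | D), by Bayes' formula. *)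
Definition posterior dT (T : measurableType dT) (R : realType)
    (Pr : probability T R) J (H : hyperparameters R J) G (n : 'I_G -> nat)
    (d : dataset R J n) (S Rh : node J -> T -> bool) (A : pred (config J)) : R :=
  (\int[Pr]_(w in [set w | A (hidden S Rh w)])
      likelihood H d (hidden S Rh w)) /
  (\int[Pr]_w likelihood H d (hidden S Rh w)).

(* Probability of an event A on the states of [subtree p] when the states are
   drawn with the posterior transition probabilities, starting from the state e
   at the parent of p.  Outside the subtree the configurations are frozen to
   e, which in particular is then the state at the parent of p. *)
Definition kernel_law (R : realType) J (H : hyperparameters R J) G
    (n : 'I_G -> nat) (d : dataset R J n) (p : node J) (e : bool * bool)
    (A : pred (config J)) : R :=
  \sum_(x : config J | A x && [forall (q | q \notin subtree p), x q == e])
    \prod_(q in subtree p) post_trans H d q (x (parent q)) (x q).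

(* Pr(A | (S, R) = e at the parent of p, D), for an event A on the states of
   [subtree p].  It is given by the transition kernels when the conditioning
   event is null; for the root, which has no parent, the conditioning is on D
   only. *)
Definition post_cond dT (T : measurableType dT) (R : realType)
    (Pr : probability T R) J (H : hyperparameters R J) G (n : 'I_G -> nat)
    (d : dataset R J n) (S Rh : node J -> T -> bool) (p : node J)
    (e : bool * bool) (A : pred (config J)) : R :=
  let B := [pred x : config J | x (parent p) == e] in
  let post := posterior Pr H d S Rh in
  if p == root_node J then post A
  else if post B == 0 then kernel_law H d p e A
  else post (predI A B) / post B.

Definition varphi dT (T : measurableType dT) (R : realType)
    (Pr : probability T R) J (H : hyperparameters R J) G (n : 'I_G -> nat)
    (d : dataset R J n) (S Rh : node J -> T -> bool) (p : node J)
    (s : bool) : R :=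
  post_cond Pr H d S Rh p (s, false)
    [pred x : config J | [forall (q | q \in subtree p), (x q).2 == false]].

(* Main.v *)
Require Import Defs.
From mathcomp Require Import all_boot all_order all_algebra.
From mathcomp Require Import all_classical all_reals all_analysis.
From mathcomp Require Import measurable_realfun zify ring lra.

(* The hidden states have finitely many configurations, and the posterior weight
   of a configuration is the product over the nodes q of
   W q (x (parent q)) (x q), the prior transition probability times the marginal
   likelihood.  Summing such a product over the states in a subtree factorizes
   into a bottom-up recursion [tree_sum]; for W itself this is the recursion of
   xi.  An event that is a conjunction of conditions on the single nodes is
   absorbed into the factors, so its conditional probability given the state at
   the parent of p is a quotient of two such recursions, in which the factors xi
   telescope: replacing W by the posterior transition probabilities P gives the
   same value without normalization.  Both "all R = 0 on the subtree" and
   "x p = e'" are events of this kind.  The quotients make sense because the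
   marginal likelihoods are positive, that is, Gamma is positive and finite,
   det(X'X + Lambda) > 0 and Upsilon >= 0. *)

Set Implicit Arguments.
Unset Strict Implicit.
Unset Printing Implicit Defensive.

Import Order.TTheory GRing.Theory Num.Theory.
Local Open Scope ring_scope.

(** * The tree *)

Lemma node_eqP J (p q : node J) : lev p = lev q -> idx p = idx q -> p = q.
Proof.
case: p => [[i k] Hp]; case: q => [[i' k'] Hq]; rewrite /lev /idx /= => e1 e2.
by apply: val_inj => /=; congr pair; apply: val_inj.
Qed.

Lemma idx_lt J (p : node J) : (idx p < 2 ^ lev p)%N.
Proof. exact: (valP p). Qed.

Lemma lev_le J (p : node J) : (lev p <= J)%N.
Proof. by rewrite -ltnS; exact: ltn_ord. Qed.

Lemma mknodeE J j k : (j <= J)%N -> (k < 2 ^ j)%N ->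
  lev (mknode J j k) = j /\ idx (mknode J j k) = k.
Proof.
move=> jJ kj; rewrite /lev /idx /mknode.
have kJ : (k < (2 ^ J).+1)%N by rewrite ltnS (leq_trans (ltnW kj))// leq_pexp2l.
rewrite val_insubd /= !inordK ?ltnS//.
by rewrite kj /= !inordK ?ltnS.
Qed.

Lemma lev_root J : lev (root_node J) = 0%N. Proof. by []. Qed.

Lemma lev_eq0 J (p : node J) : (lev p == 0%N) = (p == root_node J).
Proof.
apply/eqP/eqP => [p0|->//]; apply: node_eqP; rewrite ?lev_root//.
by have := idx_lt p; rewrite p0 ltnS leqn0 => /eqP.
Qed.

Lemma parentE J (p : node J) :
  lev (parent p) = (lev p).-1 /\ idx (parent p) = (idx p)./2.
Proof.
have lp := lev_le p; have ip := idx_lt p.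
apply: mknodeE; first exact: leq_trans (leq_pred _) lp.
case: (lev p) ip => [|l]; rewrite ?expnS ?expn0 /=; first by case: (idx p).
by move=> h; rewrite ltn_half_double -mul2n.
Qed.

Lemma childE J (p : node J) b : (lev p < J)%N ->
  lev (child p b) = (lev p).+1 /\ idx (child p b) = ((idx p).*2 + b)%N.
Proof.
move=> lp; have ip := idx_lt p; apply: mknodeE => //.
by rewrite expnS; case: b; lia.
Qed.

Lemma lev_parent J (p : node J) : lev (parent p) = (lev p).-1.
Proof. by have [] := parentE p. Qed.

Lemma lev_child J (p : node J) b : (lev p < J)%N ->
  lev (child p b) = (lev p).+1.
Proof. by case/(childE b). Qed.

Lemma parent_child J (p : node J) b : (lev p < J)%N -> parent (child p b) = p.
Proof.
move=> /(childE b)[lc ic]; have [lq iq] := parentE (child p b).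
apply: node_eqP; first by rewrite lq lc.
by rewrite iq ic; case: b {lc ic lq iq}; lia.
Qed.

Lemma child_parent J (q : node J) : q != root_node J ->
  q = child (parent q) (odd (idx q)).
Proof.
rewrite -lev_eq0 => q0; have lq := lev_le q.
have [lp ip] := parentE q.
have [lc ic] := @childE J (parent q) (odd (idx q)) ltac:(lia).
apply: node_eqP; rewrite ?lc ?ic ?lp ?ip; lia.
Qed.

Lemma lev_iter_parent J n (q : node J) :
  lev (iter n (@parent J) q) = (lev q - n)%N.
Proof. by elim: n => [|n IH] /=; rewrite ?subn0// lev_parent IH; lia. Qed.

Lemma subtreeP J (p q : node J) :
  reflect (exists n, iter n (@parent J) q = p) (q \in subtree p).
Proof.
rewrite inE; apply: (iffP idP) => [/iter_findex <-|[n <-]]; first by eexists.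
exact: fconnect_iter.
Qed.

Lemma mem_subtree J (p : node J) : p \in subtree p.
Proof. by apply/subtreeP; exists 0%N. Qed.

Lemma subtree_parent J (p q : node J) :
  parent q \in subtree p -> q \in subtree p.
Proof.
by case/subtreeP => n <-; apply/subtreeP; exists n.+1; rewrite iterSr.
Qed.

Lemma parent_subtree J (p q : node J) :
  q \in subtree p -> q != p -> parent q \in subtree p.
Proof.
case/subtreeP => [[|n]] /= <-; first by rewrite eqxx.
by move=> _; apply/subtreeP; exists n; rewrite -iterSr.
Qed.

Lemma subtree_lev J (p q : node J) : q \in subtree p -> (lev p <= lev q)%N.
Proof. by case/subtreeP => n <-; rewrite lev_iter_parent; lia. Qed.

Lemma parent_notin_subtree J (p : node J) :
  p != root_node J -> parent p \notin subtree p.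
Proof.
rewrite -lev_eq0 => p0; apply/negP => /subtree_lev; rewrite lev_parent; lia.
Qed.

Lemma subtree_root J : subtree (root_node J) = [set: node J]%SET.
Proof.
apply/setP => q; rewrite finset.in_setT; apply/subtreeP; exists (lev q).
by apply/eqP; rewrite -lev_eq0 lev_iter_parent subnn.
Qed.

(** Climb from [q] towards [p], by strong induction on the level: the last node met before [p] is
    the required child. *)
Lemma subtree_descend J (p q : node J) : q \in subtree p -> q != p ->
  exists b, q \in subtree (child p b).
Proof.
have [n] := ubnP (lev q); elim: n q => // n IH q ltn qp qNp.
have q0 : q != root_node J.
  apply: contra_neq qNp => q0; apply/eqP; rewrite eq_sym q0 -lev_eq0.
  by have := subtree_lev qp; rewrite q0 leqn0.
have := parent_subtree qp qNp.
have [<- _|pNp /IH] := eqVneq (parent q) p.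
  by exists (odd (idx q)); rewrite -child_parent// mem_subtree.
case=> //; last by move=> b /subtree_parent; exists b.
by move: q0; rewrite -lev_eq0 lev_parent; lia.
Qed.

Lemma subtree_child J (p : node J) b : (lev p < J)%N ->
  subtree (child p b) \subset subtree p.
Proof.
move=> lp; apply/fintype.subsetP => q /subtreeP[n qn].
apply/subtreeP; exists n.+1.
by rewrite iterS qn parent_child.
Qed.

Lemma notin_subtree_child J (p : node J) b : (lev p < J)%N ->
  p \notin subtree (child p b).
Proof. by move=> lp; apply/negP => /subtree_lev; rewrite lev_child// ltnn. Qed.

Lemma subtree_childrenU J (p : node J) : (lev p < J)%N ->
  subtree p = (p |: (subtree (child p false) :|: subtree (child p true)))%SET.
Proof.
move=> lp; apply/setP => q; rewrite finset.in_setU1 finset.in_setU.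
have [->|qNp] := eqVneq q p; first by rewrite mem_subtree.
apply/idP/orP => [qp|]; last first.
  by case=> [//|/orP[]]; apply: (fintype.subsetP (subtree_child _ lp)).
by right; have [[] ->] := subtree_descend qp qNp; rewrite ?orbT.
Qed.

Lemma subtree_leaf J (p : node J) : lev p = J -> subtree p = [set p]%SET.
Proof.
move=> lp; apply/setP => q; rewrite finset.in_set1.
apply/idP/eqP => [qp|->]; last exact: mem_subtree.
have [//|qNp] := eqVneq q p.
have := subtree_lev (parent_subtree qp qNp); rewrite lev_parent lp => lq.
(* As the predecessor is truncated, [J <= (lev q).-1] and [lev q <= J] do not contradict each other
   when [J] is 0; then both nodes are the root. *)
have := lev_le q => qJ; apply: node_eqP; first by lia.
have p0 : p == root_node J by rewrite -lev_eq0; lia.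
have q0 : q == root_node J by rewrite -lev_eq0; lia.
by rewrite (eqP p0) (eqP q0).
Qed.

(** Both children have the same level, so a common descendant would reach them after equally many
    steps; they would then coincide, but their indices differ by one. *)
Lemma disjoint_subtree_children J (p : node J) : (lev p < J)%N ->
  [disjoint subtree (child p false) & subtree (child p true)].
Proof.
move=> lp; apply/pred0P => q /=.
apply/negP => /andP[/subtreeP[n qn] /subtreeP[m qm]].
have [l0 i0] := childE false lp; have [l1 i1] := childE true lp.
have := lev_iter_parent n q; have := lev_iter_parent m q.
rewrite qn qm l0 l1 => nE mE; have nm : n = m by lia.
by move: i1; rewrite -qm -nm qn i0; lia.
Qed.

(** * Summation over the states of a subtree *)

(** Freezing the coordinates outside [A] to a background [c] lets sums over the states on [A] range
    over total configurations. *)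
Definition agree_off (V E : finType) (A : {set V}) (c x : {ffun V -> E}) :=
  [forall (q | q \notin A), x q == c q].

Definition upd (V E : finType) (c : {ffun V -> E}) (p : V) (v : E) :
  {ffun V -> E} := [ffun q => if q == p then v else c q].

Lemma agree_offP (V E : finType) (A : {set V}) (c x : {ffun V -> E}) :
  reflect (forall q, q \notin A -> x q = c q) (agree_off A c x).
Proof.
by apply: (iffP forall_inP) => h q /h => [/eqP|->].
Qed.

Lemma sum_agree_off1 (R : nzRingType) (V E : finType) (p : V)
    (c : {ffun V -> E}) (F : {ffun V -> E} -> R) :
  \sum_(x | agree_off [set p]%SET c x) F x = \sum_v F (upd c p v).
Proof.
rewrite (reindex_onto (upd c p) (fun x => x p)) => [|x /agree_offP xc].
  apply: eq_bigl => v; rewrite ffunE eqxx eqxx andbT; apply/agree_offP => q.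
  by rewrite finset.in_set1 ffunE => /negPf ->.
apply/ffunP => q; rewrite ffunE; case: eqVneq => [->//|qNp].
by rewrite xc// finset.in_set1.
Qed.

(** Fubini for two disjoint blocks: the configuration chosen on [A] becomes the background of the
    inner sum. *)
Lemma sum_agree_offU (R : nzRingType) (V E : finType) (A B : {set V})
    (c : {ffun V -> E}) (F : {ffun V -> E} -> R) : [disjoint A & B] ->
  \sum_(x | agree_off (A :|: B)%SET c x) F x =
  \sum_(x | agree_off A c x) \sum_(y | agree_off B x y) F y.
Proof.
move=> AB.
(* The outer variable of a configuration is its restriction to [A], completed by [c]. *)
pose r (x : {ffun V -> E}) := [ffun q => if q \in A then x q else c q].
rewrite (partition_big r (agree_off A c)) => [|x _]; last first.
  by apply/agree_offP => q /negPf qA; rewrite ffunE qA.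
apply: eq_bigr => x /agree_offP xc; apply: eq_bigl => y.
apply/andP/agree_offP => [[/agree_offP yc /eqP yx] q qB|yx].
  have [qA|qA] := boolP (q \in A); first by rewrite -yx ffunE qA.
  by rewrite xc// yc// finset.in_setU negb_or qA.
split.
  apply/agree_offP => q; rewrite finset.in_setU negb_or.
  by case/andP => qA qB; rewrite yx// xc.
apply/eqP/ffunP => q; rewrite ffunE; case: ifPn => [qA|/xc//].
by rewrite yx//; rewrite (disjointFr AB qA).
Qed.

(** Upward message passing: [h] is the height of [p] above the leaves and [e] the state at its
    parent. *)
Fixpoint tree_sum (R : nzRingType) (E : finType) J (f : node J -> E -> E -> R)
    (h : nat) (p : node J) (e : E) : R :=
  if h is h'.+1 then
    \sum_e' f p e e' *
      (tree_sum f h' (child p false) e' * tree_sum f h' (child p true) e')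
  else \sum_e' f p e e'.

Definition tree_weight (R : nzRingType) (E : finType) J
    (f : node J -> E -> E -> R) (A : {set node J})
    (x : {ffun node J -> E}) : R :=
  \prod_(q in A) f q (x (parent q)) (x q).

(** Induction on the height: once the state at [p] is fixed, the two child subtrees contribute
    independent factors. Since the root is its own parent, its factor must ignore the parent
    state. *)
Lemma sum_subtree (R : comNzRingType) (E : finType) J
    (f : node J -> E -> E -> R) h (p : node J) (c : {ffun node J -> E}) :
  (lev p + h)%N = J ->
  (p = root_node J -> forall a b v, f p a v = f p b v) ->
  \sum_(x | agree_off (subtree p) c x) tree_weight f (subtree p) x =
  tree_sum f h p (c (parent p)).
Proof.
have updp (c' : {ffun node J -> E}) q v :
    (q = root_node J -> forall a b v, f q a v = f q b v) ->
    f q (upd c' q v (parent q)) v = f q (c' (parent q)) v.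
  move=> fq; have [q0|q0] := eqVneq q (root_node J); first exact: fq.
  rewrite ffunE ifN//; apply: contraNneq (parent_notin_subtree q0) => ->.
  exact: mem_subtree.
elim: h p c => [|h IH] p c lp fp.
  rewrite addn0 in lp; rewrite (subtree_leaf lp) sum_agree_off1 /=.
  apply: eq_bigr => v _; rewrite /tree_weight big_set1.
  by rewrite [upd c p v p]ffunE eqxx updp.
have lpJ : (lev p < J)%N by lia.
have IHc b c' : \sum_(x | agree_off (subtree (child p b)) c' x)
    tree_weight f (subtree (child p b)) x = tree_sum f h (child p b) (c' p).
  rewrite IH ?lev_child ?parent_child//; first by lia.
  by move=> /(congr1 (@lev J)); rewrite lev_child.
have pN b := notin_subtree_child b lpJ.
have ppN b : parent p \notin subtree (child p b).
  exact: contra (@subtree_parent _ _ _) (pN b).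
have dis := disjoint_subtree_children lpJ.
have disp :
    [disjoint [set p]%SET &
       subtree (child p false) :|: subtree (child p true)]%SET.
  by rewrite disjoints1 finset.in_setU negb_or !pN.
rewrite (subtree_childrenU lpJ) sum_agree_offU// sum_agree_off1 /=.
apply: eq_bigr => v _; rewrite sum_agree_offU//.
set x := upd c p v.
have xp : x p = v by rewrite ffunE eqxx.
rewrite -[in RHS]xp -[in X in _ * (X * _)](IHc false x) [in RHS]mulrA.
under eq_bigr => y /agree_offP yx.
  rewrite (eq_bigr (fun z =>
    f p (c (parent p)) v * tree_weight f (subtree (child p false)) y *
    tree_weight f (subtree (child p true)) z)); last first.
    move=> z /agree_offP zy; rewrite /tree_weight big_setU1/=; last first.
      by rewrite finset.in_setU negb_or !pN.
    rewrite (eq_bigl [predU subtree (child p false) &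
        subtree (child p true)]); last first.
      by move=> q; rewrite finset.in_setU.
    rewrite bigU//= mulrA zy// zy// yx// yx// xp updp//; congr (_ * _ * _).
    (* For [q] below the first child, neither [q] nor its parent is below the second child, so this
       weight does not see the inner variable [z]. *)
    apply: eq_bigr => q qc; have qN := disjointFr dis qc.
    rewrite !zy ?qN//; apply/negP => /subtree_parent; by rewrite qN.
  rewrite -big_distrr /= IHc yx// xp.
  over.
rewrite -big_distrl/= -big_distrr /=. by rewrite xp.
Qed.

Lemma tree_sum_eq (R : nzRingType) (E : finType) J
    (f g : node J -> E -> E -> R) h p e : (lev p + h)%N = J ->
  (forall q, (lev p <= lev q)%N -> f q =2 g q) ->
  tree_sum f h p e = tree_sum g h p e.
Proof.
elim: h p e => [|h IH] p e lp fg /=; apply: eq_bigr => v _; rewrite fg//.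
have lpJ : (lev p < J)%N by lia.
have lc b : lev (child p b) = (lev p).+1 by exact: lev_child.
by congr (_ * (_ * _)); apply: IH; rewrite ?lc; try lia;
  move=> q /ltnW; exact: fg.
Qed.

(** Multiplying each factor by the indicator of a condition on the new state turns the sum over an
    event into an unconstrained sum. *)
Definition restricted (R : nzRingType) (E : finType) J (a : node J -> pred E)
  (f : node J -> E -> E -> R) p e e' : R := f p e e' * (a p e')%:R.

Definition all_on (E : finType) J (A : {set node J}) (a : node J -> pred E) :
  pred {ffun node J -> E} := fun x => [forall (q | q \in A), a q (x q)].

Lemma tree_weight_restricted (R : comNzRingType) (E : finType) J
    (f : node J -> E -> E -> R) (a : node J -> pred E) (A : {set node J}) x :
  tree_weight (restricted a f) A x = tree_weight f A x * (all_on A a x)%:R.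
Proof.
rewrite /tree_weight big_split /=; congr (_ * _).
case: (boolP (all_on A a x)) => [/forall_inP h|].
  by rewrite big1// => q qA; rewrite h.
rewrite negb_forall_in => /exists_inP[q qA /negPf aq].
by rewrite (bigD1 q)//= aq mul0r.
Qed.

Lemma sum_restricted (R : comNzRingType) (E : finType) J
    (f : node J -> E -> E -> R) (a : node J -> pred E) (A : {set node J})
    (P : pred {ffun node J -> E}) :
  \sum_(x | all_on A a x && P x) tree_weight f A x =
  \sum_(x | P x) tree_weight (restricted a f) A x.
Proof.
rewrite big_mkcondl; apply: eq_bigr => x _; rewrite tree_weight_restricted.
by case: (all_on A a x); rewrite ?mulr1 ?mulr0.
Qed.

Lemma sum_whole_tree (R : comNzRingType) (E : finType) J
    (f : node J -> E -> E -> R) e :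
  (forall a b v, f (root_node J) a v = f (root_node J) b v) ->
  \sum_x tree_weight f [set: node J]%SET x = tree_sum f J (root_node J) e.
Proof.
move=> f0.
have -> : e = [ffun _ : node J => e] (parent (root_node J)) by rewrite ffunE.
rewrite -sum_subtree// subtree_root; apply: eq_bigl => x.
by apply/esym/agree_offP => q; rewrite finset.in_setT.
Qed.

(** The subtree interacts with the other nodes only through the parent of [p], so fixing the state
    there decouples the two sides. The outer factor does not involve [g], which makes it cancel in
    quotients. *)
Lemma sum_split_subtree (R : comNzRingType) (E : finType) J
    (f g : node J -> E -> E -> R)
    h (p : node J) e : p != root_node J -> (lev p + h)%N = J ->
  \sum_(x : {ffun node J -> E} | x (parent p) == e)
    tree_weight f (~: subtree p) x * tree_weight g (subtree p) x =
  (\sum_(x : {ffun node J -> E} | agree_off (~: subtree p) [ffun => e] x)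
    tree_weight f (~: subtree p) x * (x (parent p) == e)%:R) * tree_sum g h p e.
Proof.
move=> p0 lp.
have pN := parent_notin_subtree p0.
rewrite big_mkcond.
(* The union is the whole tree, so the condition is vacuous and the background arbitrary. *)
rewrite (eq_bigl (agree_off (~: subtree p :|: subtree p)%SET [ffun => e])).
2: by move=> x; apply/esym/agree_offP => q;
  rewrite finset.setUC finset.setUCr finset.in_setT.
rewrite sum_agree_offU.
2: by rewrite disjoint_sym finset.disjoints_subset finset.setCK.
rewrite big_distrl /=; apply: eq_bigr => x _.
rewrite (eq_bigr (fun y =>
   tree_weight f (~: subtree p) x * (x (parent p) == e)%:R *
   tree_weight g (subtree p) y)).
  rewrite -big_distrr /= (sum_subtree _ lp) => [|/eqP].
    2: by rewrite (negPf p0).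
  by case: eqP => [->//|_]; rewrite mulr0 !mul0r.
move=> y /agree_offP yx; rewrite yx//.
have -> : tree_weight f (~: subtree p) y = tree_weight f (~: subtree p) x.
  apply: eq_bigr => q; rewrite finset.in_setC => qN; rewrite !yx//.
  exact: contra (@subtree_parent _ _ _) qN.
by case: eqP => _; rewrite ?mulr1 ?mulr0 ?mul0r.
Qed.

Lemma tree_weight_setT (R : comNzRingType) (E : finType) J
    (f : node J -> E -> E -> R) p x :
  tree_weight f [set: node J]%SET x =
  tree_weight f (~: subtree p)%SET x * tree_weight f (subtree p) x.
Proof.
rewrite /tree_weight (bigID (mem (subtree p))) /= mulrC; congr (_ * _).
all: by apply: eq_bigl => q; rewrite finset.in_setT ?finset.in_setC.
Qed.

(** * Positivity of the marginal likelihood *)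

Lemma powR_le_expR (R : realType) (c : R) : 0 < c ->
  exists2 C, 0 < C & forall t, 0 < t -> t `^ c <= C * expR (t / 2).
Proof.
(* The exponent is the maximum of c ln t - t/2, attained at t = 2c; the bound follows from ln q <= q
   - 1 with q = t/(2c). *)
move=> c0; exists (expR (c * (ln (2 * c) - 1))); first exact: expR_gt0.
move=> t t0; rewrite /powR gt_eqF// -expRD ler_expR.
have c20 : 0 < 2 * c by lra.
have q0 : 0 < t / (2 * c) by rewrite divr_gt0.
have h : ln (t / (2 * c)) <= t / (2 * c) - 1.
  have := @le_ln1Dx R (t / (2 * c) - 1).
  by rewrite [1 + _]addrC subrK; apply; lra.
have tE : t = t / (2 * c) * (2 * c) by rewrite divfK// gt_eqF.
move: (t / (2 * c)) => q in q0 h tE *; rewrite tE (lnM q0 c20).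
have : c * ln q <= c * (q - 1) by rewrite ler_pM2l.
lra.
Qed.

Section GammaPositivity.
Local Open Scope classical_set_scope.

(* A divergent integral would make Gamma 0, so its finiteness matters here. *)
Lemma Gamma_gt0 (R : realType) (a : R) : 1 < a -> 0 < Gamma a.
Proof.
move=> a1; have c0 : 0 < a - 1 by lra.
pose f (t : R) := t `^ (a - 1) * expR (- t).
have mf (D : set (measurableTypeR R)) :
    measurable_fun D (f : measurableTypeR R -> measurableTypeR R).
  apply: (@measurable_funS _ _ _ _ setT) => //.
  apply: measurable_funM; first exact: measurable_powR.
  by apply: measurableT_comp => //; exact: measurable_expR.
have f0 t : 0 <= f t by rewrite mulr_ge0 ?powR_ge0 ?expR_ge0.
(* The integrand is dominated by a multiple of the exponential density of rate 1/2. *)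
have fin : (@lebesgue_measure R).-integrable `]0, +oo[ (EFin \o f).
  have [C C0 fC] := powR_le_expR c0.
  have r0 : 0 < 2^-1 :> R by lra.
  have hI : (@lebesgue_measure R).-integrable `]0, +oo[
      (fun t => (2 * C)%:E * (exponential_pdf 2^-1 t)%:E)%E.
    apply: (@integrableS _ _ _ _ setT) => //.
    exact: integrableZl (integrable_exponential_pdf r0).
  apply: le_integrable hI => //; first by apply/measurable_EFinP; exact: mf.
  move=> t /=; rewrite in_itv/= andbT => t0.
  rewrite lee_fin ger0_norm ?f0// exponential_pdfE ?(ltW t0)// ger0_norm.
  2: by rewrite !mulr_ge0 ?expR_ge0//; lra.
  have -> : 2 * C * (2^-1 * expR (- 2^-1 * t)) = C * expR (t / 2) * expR (- t).
    rewrite -[RHS]mulrA -expRD; have -> : t / 2 - t = - 2^-1 * t by lra.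
    lra.
  by rewrite ler_wpM2r ?expR_ge0 ?fC.
rewrite /Gamma /Rintegral fine_gt0//; apply/andP; split; last first.
  have [_] := integrableP _ _ _ fin.
  apply: le_lt_trans; rewrite ge0_le_integral//.
  - by move=> t _; rewrite lee_fin f0.
  - by apply/measurable_EFinP; exact: mf.
  - by apply: measurableT_comp => //; by apply/measurable_EFinP; exact: mf.
  - by move=> t _; rewrite lee_fin ler_norm.
(* For positivity, the interval [1, 2] suffices: there the integrand is at least exp(-2). *)
have s12 : `[1, 2] `<=` (`]0, +oo[ : set R).
  by move=> t /=; rewrite !in_itv/= andbT; lra.
have sub : (\int[@lebesgue_measure R]_(t in `[1%R, 2%R]) (f t)%:E <=
    \int[@lebesgue_measure R]_(t in `]0%R, +oo[) (f t)%:E)%E.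
  apply: ge0_subset_integral => //; first by apply/measurable_EFinP; exact: mf.
  by move=> t _; rewrite lee_fin f0.
apply: lt_le_trans sub.
have : (\int[@lebesgue_measure R]_(t in `[1%R, 2%R]) (expR (- 2))%:E <=
    \int[@lebesgue_measure R]_(t in `[1%R, 2%R]) (f t)%:E)%E.
  apply: ge0_le_integral => //.
  - by apply/measurable_EFinP; exact: mf.
  - move=> t; rewrite /= in_itv/= => /andP[t1 t2]; rewrite lee_fin.
    rewrite -[leLHS]mul1r ler_pM ?expR_ge0// ?ler_expR; last by lra.
    have : 1 `^ (a - 1) <= t `^ (a - 1).
      by apply: ge0_ler_powR; rewrite ?nnegrE; lra.
    by rewrite powR1.
apply: lt_le_trans.
rewrite integral_cst//= lebesgue_measure_itv/= lte_fin ltr1n/=.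
by rewrite -EFinB -EFinM lte_fin mulr_gt0 ?expR_gt0//; lra.
Qed.

End GammaPositivity.

Lemma sqr_norm_ge0 (R : realFieldType) m (u : 'cV[R]_m) : 0 <= (u^T *m u) 0 0.
Proof. by rewrite mxE sumr_ge0// => i _; rewrite mxE -expr2 sqr_ge0. Qed.

Section Ridge.
Variables (R : rcfType) (m g : nat) (X : 'M[R]_(m, g)) (l : 'rV[R]_g).
Hypothesis l0 : forall i, 0 < l 0 i.

Lemma diag_form_gt0 (u : 'cV[R]_g) : u != 0 -> 0 < (u^T *m diag_mx l *m u) 0 0.
Proof.
move=> /matrix0Pn[i [j uij]]; rewrite mxE.
have E k : (u^T *m diag_mx l) 0 k * u k 0 = l 0 k * u k 0 ^+ 2.
  by rewrite mul_mx_diag !mxE; ring.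
under eq_bigr do rewrite E.
rewrite (bigD1 i)//= ltr_pwDl//.
  by rewrite mulr_gt0// lt_def sqr_ge0 sqrf_eq0 -(ord1 j) uij.
by rewrite sumr_ge0// => k _; rewrite mulr_ge0 ?sqr_ge0// ltW.
Qed.

(** A vector v in the kernel would make t |Xv|^2 plus the positive definite diagonal form vanish. *)
Lemma ridge_det_neq0 (t : R) : 0 <= t ->
  \det (t *: (X^T *m X) + diag_mx l) != 0.
Proof.
move=> t0; apply/eqP => d0.
have /det0P[v v0 vM] : \det (t *: (X^T *m X) + diag_mx l) == 0 by rewrite d0.
have := @diag_form_gt0 v^T; rewrite trmx_eq0 trmxK => /(_ v0).
have : 0 <= (v *m (t *: (X^T *m X)) *m v^T) 0 0.
  rewrite -scalemxAr -scalemxAl mxE mulr_ge0//.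
  by have := sqr_norm_ge0 (X *m v^T); rewrite trmx_mul trmxK !mulmxA.
have : (v *m (t *: (X^T *m X) + diag_mx l) *m v^T) 0 0 = 0.
  by rewrite vM mul0mx mxE.
rewrite mulmxDr mulmxDl mxE; lra.
Qed.

(* t |-> det(t X'X + Lambda) has no root on [0, 1] and is positive at 0. *)
Lemma ridge_det_gt0 : 0 < \det (X^T *m X + diag_mx l).
Proof.
pose M : 'M[{poly R}]_g :=
  'X *: map_mx polyC (X^T *m X) + map_mx polyC (diag_mx l).
have ME t : (\det M).[t] = \det (t *: (X^T *m X) + diag_mx l).
  rewrite -horner_evalE -det_map_mx; congr (\det _); apply/matrixP => i j.
  by rewrite !mxE /= /horner_eval !hornerE.
have M0 : 0 < (\det M).[0].
  by rewrite ME scale0r add0r det_diag prodr_gt0.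
have := @ridge_det_neq0 1 ler01; rewrite scale1r lt_neqAle eq_sym => -> /=.
rewrite leNgt; apply/negP => lt0.
(* The sign is flipped because [poly_ivt] expects a nonpositive value at the left end and a
   nonnegative one at the right. *)
have [||x /andP[x0 x1] /rootP] := @poly_ivt R (- \det M) 0 1.
- exact: ler01.
- by rewrite !hornerN !ME scale1r oppr_le0 oppr_ge0 -ME !ltW.
by rewrite hornerN ME => /eqP; rewrite oppr_eq0 (negPf (ridge_det_neq0 x0)).
Qed.

(** Completing the square with the normal equations M mu = X'y gives y'y - mu'M mu = |y - X mu|^2 +
    mu' diag(l) mu. *)
Lemma ridge_residual_ge0 (y : 'cV[R]_m) (M : 'M[R]_g) (mu : 'cV[R]_g) :
  M = X^T *m X + diag_mx l -> mu = invmx M *m X^T *m y ->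
  0 <= (y^T *m y - mu^T *m M *m mu) 0 0.
Proof.
move=> ME muE.
have Mu : M \in unitmx by rewrite unitmxE unitfE ME gt_eqF// ridge_det_gt0.
have Mmu : M *m mu = X^T *m y by rewrite muE -!mulmxA mulKVmx.
have -> : y^T *m y - mu^T *m M *m mu =
    (y - X *m mu)^T *m (y - X *m mu) + mu^T *m diag_mx l *m mu.
  have e1 : mu^T *m M *m mu = mu^T *m X^T *m y by rewrite -mulmxA Mmu mulmxA.
  have e2 : y^T *m X *m mu = mu^T *m X^T *m y.
    have -> : y^T *m X *m mu = (y^T *m X *m mu)^T.
      by apply/matrixP => i j; rewrite !ord1 [RHS]mxE.
    by rewrite !trmx_mul trmxK mulmxA.
  have e3 : mu^T *m M *m mu = mu^T *m X^T *m X *m mu + mu^T *m diag_mx l *m mu.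
    by rewrite {1}ME mulmxDr mulmxDl !mulmxA.
  rewrite [(y - _)^T]linearB/= trmx_mul mulmxBl !mulmxBr !mulmxA e2.
  move: e3; rewrite e1 => ->.
  by rewrite opprB opprD !addrA; apply/matrixP => i j; rewrite !mxE; ring.
rewrite mxE addr_ge0 ?sqr_norm_ge0//.
have [->|/diag_form_gt0/ltW//] := eqVneq mu 0; by rewrite mulmx0 mxE.
Qed.
End Ridge.

Lemma marglik_gt0 (R : realType) J (H : hyperparameters R J) G
    (n : 'I_G -> nat) (d : dataset R J n) (p : node J) (s r : bool) :
  0 < marglik H d p s r.
Proof.
have nu0 := nu_gt0 H; have s0 := sigma02_gt0 H.
have b0 : 0 < nu H * sigma02 H by rewrite mulr_gt0.
have n0 : 0 <= (\sum_g n g)%:R / 2 :> R by rewrite divr_ge0.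
pose l : 'rV[R]_G := \row_g (if g == 0%N :> nat then (tau_ H (lev p))^-1
                   else (upsilon_ H (lev p))^-1).
have l0 i : 0 < l 0 i.
  rewrite mxE; case: ifP => _; rewrite invr_gt0 mulr_gt0 ?powR_gt0//.
    exact: tau_gt0.
  exact: upsilon_gt0.
have U0 : 0 <= Upsilon H d p s r.
  by rewrite mulr_ge0 ?invr_ge0//;
    exact: (@ridge_residual_ge0 _ _ _ (design R n s r) l).
have det0 : 0 < \det (Lambda H G (lev p)) by rewrite det_diag prodr_gt0.
have det1 : 0 < \det (Lambda_star H n (lev p) s r).
  exact: (@ridge_det_gt0 _ _ _ (design R n s r) l).
rewrite /marglik mulr_gt0//; last by rewrite powR_gt0// ltr_wpDr.
rewrite mulr_gt0//; last by rewrite divr_gt0 ?sqrtr_gt0.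
rewrite divr_gt0// mulr_gt0 ?powR_gt0 ?mulr_gt0 ?pi_gt0// Gamma_gt0//; lra.
Qed.

(** * The posterior as a finite sum *)

Section FinitePosterior.
Local Open Scope classical_set_scope.
Local Open Scope ring_scope.

(** The integrand is a finite combination of indicators of the fibres of [X]; nonnegativity of [g]
    allows integrating term by term. *)
Lemma Rintegral_finite_range d (T : measurableType d) (R : realType)
    (Pr : probability T R) (C : finType) (X : T -> C) (g : C -> R)
    (A : pred C) :
  (forall c, measurable [set w | X w = c]) -> (forall c, 0 <= g c) ->
  \int[Pr]_(w in [set w | A (X w)]) g (X w) =
  \sum_(c | A c) g c * fine (Pr [set w | X w = c]).
Proof.
move=> mX g0.
rewrite Rintegral_mkcond /Rintegral.
rewrite (eq_integral (fun w => \sum_(c in C)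
  (if A c then g c else 0)%:E * (\1_[set w | X w = c] w)%:E)%E); last first.
  move=> w _; rewrite (bigD1 (X w))//= big1 ?adde0 => [|c cX].
    rewrite indicE /= mem_set//= mule1; congr EFin; rewrite /patch; case: ifPn.
      by rewrite inE /= => ->.
    by rewrite notin_setE /=; case: (A _).
  by rewrite indicE memNset ?mule0//= => wc; rewrite wc eqxx in cX.
rewrite ge0_integral_sum//; last 2 first.
- move=> c; apply: emeasurable_funM => //; apply/measurable_EFinP.
  exact: measurable_indic.
- by move=> c w _; rewrite mule_ge0 ?lee_fin//; case: ifP.
rewrite (eq_bigr (fun c =>
  ((if A c then g c else 0) * fine (Pr [set w | X w = c]))%:E)).
  rewrite sumEFin /= [RHS]big_mkcond /=; apply: eq_bigr => c _.
  by case: ifP => // _; rewrite mul0r.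
move=> c _; rewrite ge0_integralZl//=.
- rewrite integral_indic// setIT EFinM fineK//.
  exact: fin_num_measure.
- by apply/measurable_EFinP; exact: measurable_indic.
- by rewrite lee_fin; case: ifP.
Qed.

Lemma measurable_hidden d (T : measurableType d) (R : realType)
    (Pr : probability T R) J (S Rh : node J -> {RV Pr >-> bool})
    (x : config J) :
  measurable [set w | hidden S Rh w = x].
Proof.
have mp (X : {RV Pr >-> bool}) b : measurable [set w | X w = b].
  rewrite -[X in measurable X]setTI.
  by have := @measurable_funPT _ _ _ _ X => /(_ measurableT [set b] I).
have -> : [set w | hidden S Rh w = x] =
   \bigcap_(p in [set: node J])
     ([set w | S p w = (x p).1] `&` [set w | Rh p w = (x p).2]).
  apply/seteqP; split => [w <- p _|w h] /=; first by rewrite ffunE.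
  by apply/ffunP => p; rewrite ffunE; have [-> ->] := h p I; case: (x p).
apply: fin_bigcap_measurable; first exact: finite_finset.
by move=> p _; apply: measurableI.
Qed.

Definition node_weight (R : realType) J (H : hyperparameters R J) G
    (n : 'I_G -> nat) (d : dataset R J n) (p : node J)
    (e e' : bool * bool) : R :=
  prior_trans H p e e' * marglik H d p e'.1 e'.2.

(** Independence multiplies the two Markov tree formulas, whose factors are regrouped node by node;
    at the root [prior_trans] supplies the initial probabilities. *)
Lemma hidden_prob d (T : measurableType d) (R : realType)
    (Pr : probability T R) J (S Rh : node J -> T -> bool)
    (H : hyperparameters R J) (x : config J) :
  is_MT Pr (rho0 H) (rho H) S -> is_MT Pr (kappa0 H) (kappa H) Rh ->
  indep_families Pr S Rh ->
  Pr [set w | hidden S Rh w = x] =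
  (\prod_p prior_trans H p (x (parent p)) (x p))%:E.
Proof.
move=> hS hR /(_ [ffun p => (x p).1] [ffun p => (x p).2]).
rewrite hS hR.
have -> : [set w | (forall p, S p w = [ffun p => (x p).1] p) /\
     (forall p, Rh p w = [ffun p => (x p).2] p)] = [set w | hidden S Rh w = x].
  apply/seteqP; split => [w [h1 h2]|w <-] /=.
    by apply/ffunP => p; rewrite ffunE h1 h2 !ffunE; case: (x p).
  by split=> p; rewrite !ffunE.
move=> ->; rewrite -EFinM; congr EFin.
rewrite mulrACA -big_split /=.
rewrite [RHS](bigD1 (root_node J))//= /prior_trans eqxx !ffunE.
by congr (_ * _); apply: eq_bigr => p /negPf ->; rewrite !ffunE.
Qed.

Lemma posteriorE d (T : measurableType d) (R : realType)
    (Pr : probability T R) J (S Rh : node J -> {RV Pr >-> bool})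
    (H : hyperparameters R J) G (n : 'I_G -> nat) (D : dataset R J n)
    (A : pred (config J)) :
  is_MT Pr (rho0 H) (rho H) S -> is_MT Pr (kappa0 H) (kappa H) Rh ->
  indep_families Pr S Rh ->
  (forall p s r, 0 <= marglik H D p s r) ->
  posterior Pr H D S Rh A =
  (\sum_(x | A x) tree_weight (node_weight H D) [set: node J]%SET x) /
  (\sum_x tree_weight (node_weight H D) [set: node J]%SET x).
Proof.
move=> hS hR hSR m0.
have E (B : pred (config J)) :
    \int[Pr]_(w in [set w | B (hidden S Rh w)]) likelihood H D (hidden S Rh w) =
    \sum_(x | B x) tree_weight (node_weight H D) [set: node J]%SET x.
  rewrite (@Rintegral_finite_range _ _ _ _ _ (hidden S Rh) (likelihood H D)
    B); first last.
  - by move=> x; apply: prodr_ge0.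
  - exact: measurable_hidden.
  apply: eq_bigr => x _; rewrite (hidden_prob x hS hR hSR) /=.
  rewrite /likelihood /tree_weight.
  rewrite -big_split /=; apply: eq_big => p; first by rewrite finset.in_setT.
  by rewrite mulrC.
rewrite /posterior E; congr (_ / _).
by rewrite -(E predT); congr (Rintegral _ _ _); apply/seteqP; split.
Qed.

End FinitePosterior.

(** * Posterior transition kernels and their normalizers *)

Section PosteriorTransitions.
Variables (R : realType) (J G : nat) (n : 'I_G -> nat)
  (H : hyperparameters R J) (d : dataset R J n).

Local Notation E := (bool * bool)%type.
Local Notation W := (node_weight H d).

Lemma sum_prior_trans p e : \sum_e' prior_trans H p e e' = 1.
Proof.
have sumM (a b : bool -> R) : \sum_x a x = 1 -> \sum_x b x = 1 ->
    \sum_(e : E) a e.1 * b e.2 = 1.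
  by move=> a1 b1;
    rewrite -(pair_bigA _ (fun i j => a i * b j)) -big_distrlr/= a1 b1 mulr1.
rewrite /prior_trans; case: eqVneq => [_|p0].
  by apply: sumM; [have [] := rho0_prob H|have [] := kappa0_prob H].
by apply: sumM; [have [] := rho_prob H e.1 p0|have [] := kappa_prob H e.2 p0].
Qed.

Lemma prior_trans_ge0 p e e' : 0 <= prior_trans H p e e'.
Proof.
rewrite /prior_trans; case: eqVneq => [_|p0]; rewrite mulr_ge0//.
- by have [] := rho0_prob H.
- by have [] := kappa0_prob H.
- by have [] := rho_prob H e.1 p0.
- by have [] := kappa_prob H e.2 p0.
Qed.

(** Single prior probabilities may vanish, but as they sum to 1 at least one is positive. *)
Lemma prior_mean_gt0 p e (F : E -> R) : (forall e', 0 < F e') ->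
  0 < \sum_e' prior_trans H p e e' * F e'.
Proof.
move=> F0; rewrite lt_def sumr_ge0 ?andbT; last first.
  by move=> e' _; rewrite mulr_ge0 ?prior_trans_ge0// ltW.
rewrite psumr_neq0.
2: by move=> e' _; rewrite mulr_ge0 ?prior_trans_ge0// ltW.
have : \sum_e' prior_trans H p e e' != 0 by rewrite sum_prior_trans oner_eq0.
rewrite psumr_neq0; last by move=> e' _; exact: prior_trans_ge0.
case/hasP => e' e'in /= h; apply/hasP; exists e' => //=.
by rewrite mulr_gt0.
Qed.

Lemma phi_gt0 p e : 0 < phi H d p e.
Proof.
rewrite /phi; move: (J - lev p)%N => h; elim: h p e => [|h IH] p e /=.
  exact: marglik_gt0.
by apply: mulr_gt0; [apply: mulr_gt0; [exact: marglik_gt0|]|];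
  apply: prior_mean_gt0 => e'; exact: IH.
Qed.

Lemma xi_gt0 p e : 0 < xi H d p e.
Proof. exact: prior_mean_gt0 (phi_gt0 p). Qed.

(** Since [phi] is the marginal likelihood times the [xi] of the children, moving the likelihood
    into [node_weight] turns one recursion into the other. *)
Lemma xi_tree_sum p h e : (lev p + h)%N = J -> xi H d p e = tree_sum W h p e.
Proof.
rewrite /xi /phi => lp; have -> : (J - lev p)%N = h by lia.
elim: h p e lp => [|h IH] p e lp /=; apply: eq_bigr => v _ //=.
have lc b : (lev (child p b) + h)%N = J by rewrite lev_child//; lia.
rewrite !IH// -[W p e v]/(prior_trans H p e v * marglik H d p v.1 v.2).
move: (marglik H d p v.1 v.2) => m.
by rewrite !mulrA.
Qed.

(* The factors xi telescope along the subtree. *)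
Lemma tree_sum_post_trans a h p e : (lev p + h)%N = J ->
  tree_sum (restricted a (post_trans H d)) h p e =
  tree_sum (restricted a W) h p e / xi H d p e.
Proof.
elim: h p e => [|h IH] p e lp /=; rewrite big_distrl/=; apply: eq_bigr => v _.
  rewrite /restricted /post_trans /node_weight /phi.
  have -> : (J - lev p)%N = 0%N by lia.
  by rewrite /=; move: (marglik H d p v.1 v.2) => m; rewrite mulrAC.
have lpJ : (lev p < J)%N by lia.
have lc b : (lev (child p b) + h)%N = J by rewrite lev_child//; lia.
rewrite !IH// /restricted /post_trans /node_weight.
have -> : phi H d p v =
    marglik H d p v.1 v.2 * xi H d (child p false) v * xi H d (child p true) v.
  rewrite /xi /phi !lev_child//; have -> : (J - lev p)%N = h.+1 by lia.
  by have -> : (J - (lev p).+1)%N = h by lia.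
move: (marglik H d p v.1 v.2) => m.
by field; rewrite !gt_eqF ?xi_gt0.
Qed.

(** This is the telescoped quotient for the trivial event, whose numerator is [xi] itself: the
    kernels are stochastic. *)
Lemma tree_sum_post_trans1 h p e : (lev p + h)%N = J ->
  tree_sum (post_trans H d) h p e = 1.
Proof.
move=> lp; have E (f : node J -> E -> E -> R) :
    tree_sum f h p e = tree_sum (restricted (fun _ => predT) f) h p e.
  by apply: tree_sum_eq => // q _ x y; rewrite /restricted mulr1.
rewrite E tree_sum_post_trans// -E -(xi_tree_sum _ lp).
by rewrite divff// gt_eqF ?xi_gt0.
Qed.

End PosteriorTransitions.

(** * Posterior conditional probabilities as bottom-up recursions *)

Section PosteriorConditionals.
Variables (R : realType) (J G : nat) (n : 'I_G -> nat)
  (H : hyperparameters R J) (d : dataset R J n)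
  (dT : measure_display) (T : measurableType dT) (Pr : probability T R)
    (S Rh : node J -> {RV Pr >-> bool}).
Hypotheses
    (hS : is_MT Pr (rho0 H) (rho H) S)
    (hR : is_MT Pr (kappa0 H) (kappa H) Rh)
    (hSR : indep_families Pr S Rh).
Local Notation E := (bool * bool)%type.
Local Notation W := (node_weight H d).
Local Notation P := (post_trans H d).

Let m0 p s r : 0 <= marglik H d p s r. Proof. by rewrite ltW// marglik_gt0. Qed.

Lemma post_trans_root a b v : P (root_node J) a v = P (root_node J) b v.
Proof. by rewrite /post_trans /xi /prior_trans eqxx. Qed.

Lemma kernel_lawE h (p : node J) e (A : pred (config J))
    (a : node J -> pred E) :
  (lev p + h)%N = J -> A =1 all_on (subtree p) a ->
  kernel_law H d p e A = tree_sum (restricted a P) h p e.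
Proof.
move=> lp Aa; have -> : e = [ffun _ : node J => e] (parent p) by rewrite ffunE.
rewrite -sum_subtree//; last first.
  by move=> -> x y v; rewrite /restricted (post_trans_root x y).
rewrite -sum_restricted; apply: eq_big => [x|x _]; last by [].
rewrite Aa; congr (_ && _); apply: eq_forallb => q; by rewrite !ffunE.
Qed.

Lemma posterior_total_gt0 : 0 < \sum_x tree_weight W [set: node J]%SET x.
Proof.
rewrite (sum_whole_tree (false, false)) => [|x y v]; last first.
  by rewrite /node_weight /prior_trans eqxx.
by rewrite -xi_tree_sum// xi_gt0.
Qed.

(** All three cases of [post_cond] agree: at the root it is a quotient of sums over the whole tree,
    a null conditioning event is covered by [kernel_lawE], and otherwise numerator and denominator
    share the factor from outside the subtree. *)
Lemma post_condE h (p : node J) e (A : pred (config J))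
    (a : node J -> pred E) :
  (lev p + h)%N = J -> A =1 all_on (subtree p) a ->
  post_cond Pr H d S Rh p e A = tree_sum (restricted a P) h p e.
Proof.
move=> lp Aa; rewrite /post_cond; case: eqVneq => [p0|p0].
  have hJ : h = J by rewrite -lp p0.
  rewrite tree_sum_post_trans// (xi_tree_sum H d e lp) p0 hJ posteriorE//.
  have W0 x y v : W (root_node J) x v = W (root_node J) y v.
    by rewrite /node_weight /prior_trans eqxx.
  have aW0 x y v :
      restricted a W (root_node J) x v = restricted a W (root_node J) y v.
    by rewrite /restricted (W0 x y).
  rewrite -!sum_whole_tree//.
  congr (_ / _); have := sum_restricted W a [set: node J]%SET predT => <-.
  by apply: eq_bigl => x; rewrite Aa p0 subtree_root andbT.
case: eqVneq => [_|]; first exact: kernel_lawE.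
rewrite !posteriorE// => B0.
have Z0 := lt0r_neq0 posterior_total_gt0.
rewrite tree_sum_post_trans// (xi_tree_sum H d e lp).
have := @sum_split_subtree _ _ _ W W h p e p0 lp.
under eq_bigr do rewrite -tree_weight_setT.
move=> NB; move: B0; rewrite NB.
have -> : \sum_(x : config J | 
      predI A [pred x : config J | x (parent p) == e] x)
    tree_weight W [set: node J]%SET x =
  \sum_(x : config J | x (parent p) == e) tree_weight W (~: subtree p)%SET x *
     tree_weight (restricted a W) (subtree p) x.
  rewrite big_mkcondl; apply: eq_bigr => x _.
  rewrite Aa (tree_weight_setT _ p) tree_weight_restricted.
  by case: (all_on _ a x); rewrite ?mulr1 ?mulr0.
(* [C] is the common outer factor; it is nonzero because the conditioning event has nonzero
   posterior probability. *)
rewrite (sum_split_subtree _ _ _ p0 lp); set C := \sum_(x | _) _ => B0.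
have C0 : C != 0 by apply: contraNneq B0 => ->; rewrite !mul0r.
by field; rewrite Z0 C0 -(xi_tree_sum H d e lp) gt_eqF ?xi_gt0.
Qed.
End PosteriorConditionals.

(** * The recursion and the joint null and alternative probabilities *)

Lemma restricted_sum_snd (R : comNzRingType) (F : bool * bool -> R) :
  \sum_e F e * (e.2 == false)%:R = \sum_s F (s, false).
Proof.
rewrite (eq_bigr (fun e => F (e.1, e.2) * (e.2 == false)%:R)); last by case.
rewrite -(pair_bigA _ (fun i j => F (i, j) * (j == false)%:R)) /=.
apply: eq_bigr => s _; by rewrite big_bool/= mulr0 add0r mulr1.
Qed.

Theorem corollary2 (R : realType) (J G : nat) (hG : (2 <= G)%N)
    (n : 'I_G -> nat) (hn : forall g, (1 <= n g)%N)
    (H : hyperparameters R J) (d : dataset R J n)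
    (dT : measure_display) (T : measurableType dT) (Pr : probability T R)
    (S Rh : node J -> {RV Pr >-> bool})
    (hS : is_MT Pr (rho0 H) (rho H) S)
    (hR : is_MT Pr (kappa0 H) (kappa H) Rh)
    (hSR : indep_families Pr S Rh) :
  let post := posterior Pr H d S Rh in
  let cond := post_cond Pr H d S Rh in
  let P := post_trans H d in
  let phi0 := varphi Pr H d S Rh in
  (forall (p : node J) (e e' : bool * bool),
      P p e e' = cond p e [pred x : config J | x p == e']) /\
  (forall (p : node J) (s : bool),
      phi0 p s =
      if (lev p < J)%N then
        \sum_(s' : bool) P p (s, false) (s', false) *
          phi0 (child p false) s' * phi0 (child p true) s'
      else \sum_(s' : bool) P p (s, false) (s', false)) /\
  post [pred x : config J | [forall p, (x p).2 == false]] =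
    phi0 (root_node J) false /\
  post [pred x : config J | [exists p, (x p).2 == true]] =
    1 - phi0 (root_node J) false.
Proof.
move=> post cond P phi0.
pose a0 (q : node J) : pred (bool * bool) := fun v => v.2 == false.
have phi0E h p s : (lev p + h)%N = J ->
    phi0 p s = tree_sum (restricted a0 P) h p (s, false).
  by move=> lp; apply: post_condE.
have post0 : post [pred x : config J | [forall p, (x p).2 == false]] =
    phi0 (root_node J) false.
  rewrite /phi0 /varphi /post_cond eqxx; congr (posterior _ _ _ _ _ _).
  apply/funext => x /=; apply: eq_forallb => q.
  by rewrite subtree_root finset.in_setT.
split; [|split; [|split=> //]].
- move=> p e e'; have lp : (lev p + (J - lev p))%N = J.
    by rewrite subnKC ?lev_le.
  (* The event on the single node [p] becomes an event on its subtree, with vacuous conditions at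
     the proper descendants. *)
  pose a (q : node J) : pred (bool * bool) := fun v => (q == p) ==> (v == e').
  rewrite /cond (post_condE d hS hR hSR e lp (a := a)); last first.
    move=> x /=; apply/idP/forall_inP => [xp q _|/(_ p (mem_subtree p))].
    2: by rewrite /a eqxx.
    by apply/implyP => /eqP ->.
  have aE v : restricted a P p e v = (if v == e' then P p e e' else 0).
    rewrite /restricted /a eqxx/=.
    by case: eqP => [->|_]; rewrite ?mulr1 ?mulr0.
  case: (J - lev p)%N lp => [|h] lp /=.
    by under eq_bigr do rewrite aE; rewrite -big_mkcond /= big_pred1_eq.
  rewrite (eq_bigr (fun v => if v == e' then P p e e' else 0)) => [|v _].
    by rewrite -big_mkcond /= big_pred1_eq.
  have lpJ : (lev p < J)%N by lia.
  (* Below [p] the restriction disappears, and the stochastic kernels have total mass 1. *)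
  have one b : tree_sum (restricted a P) h (child p b) v = 1.
    rewrite -(tree_sum_post_trans1 H d (p := child p b) (h := h) v); last first.
      by rewrite lev_child//; lia.
    apply: tree_sum_eq; first by rewrite lev_child//; lia.
    move=> q; rewrite lev_child// => lq x y; rewrite /restricted /a.
    have /negPf -> : q != p by apply: contraTneq lq => ->; rewrite ltnn.
    by rewrite mulr1.
  by rewrite !one !mulr1 aE.
- move=> p s; have lp : (lev p + (J - lev p))%N = J.
    by rewrite subnKC ?lev_le.
  rewrite (phi0E _ _ _ lp); case: ltnP => lpJ; last first.
    have -> : (J - lev p)%N = 0%N by lia.
    exact: restricted_sum_snd.
  have -> : (J - lev p)%N = (J - (lev p).+1).+1 by lia.
  rewrite /= /restricted /a0.
  (* The indicator is moved last, so that the sum over pairs collapses to the states with second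
     component 0. *)
  under eq_bigr do rewrite mulrAC.
  rewrite (restricted_sum_snd (fun v => _ * _)); apply: eq_bigr => s' _.
  by rewrite mulrA !(phi0E (J - (lev p).+1)%N) ?lev_child//; lia.
- rewrite -post0 /post !posteriorE//;
    try by move=> *; rewrite ltW// marglik_gt0.
  have Z0 := lt0r_neq0 (posterior_total_gt0 H d).
  (* Writing 1 as the total weight over itself leaves a comparison of numerators: the total minus
     the null event is its complement. *)
  rewrite -[1](divff Z0) -mulrBl; congr (_ / _).
  rewrite [X in _ = X - _](bigID [pred x : config J |
    [forall p, (x p).2 == false]]) /=.
  rewrite addrC addrK; apply: eq_bigl => x; rewrite negb_forall.
  by apply: eq_existsb => q; case: (x q).2.
Qed.
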